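(* For problem (D) with $\Psi_\mu=\Psi_{0,\mu}$: (i) every stationary point of (D) is a local minimizer of $G$; (ii) if $w^*=[y^*;z^*]$ is a local minimizer of $G$ with $G(w^* )<\infty$ and the Slater condition $$\{w=[y;z]:\ -A^\top y-B^\top z\in\operatorname{ri}(\operatorname{dom}f^* ),\ y\in\operatorname{ri}(\operatorname{dom}g^* ),\ z_{\bar T_*}=0\}\neq\emptyset$$ holds, where $T_*=\{i:z^*_i\ne0\}$, $\bar T_*=[r]\setminus T_*$, and ''$\operatorname{ri}$'' may be omitted for $f^*$ (resp. $g^*$) when it is polyhedral, then $w^*$ is a stationary point of (D).
   Context: Let $f:\mathbb R^n\to(-\infty,\infty]$, $g:\mathbb R^m\to(-\infty,\infty]$ be proper, lsc and convex with conjugates $f^*,g^*$; $A\in\mathbb R^{m\times n}$, $B\in\mathbb R^{r\times n}$, $b\in\mathbb R^r$, $\mu\in\mathbb R^r$, $\mu>0$. For $w=[y;z]\in\mathbb R^m\times\mathbb R^r$: $\Xi(w)=f^*(-A^\top y-B^\top z)+g^*(y)+\langle b,z\rangle$, $\Psi_{0,\mu}(z)=\sum_i\mu_i\mathbf 1_{\{z_i\neq0\}}$, and (D) is $\min_w G(w)=\Xi(w)+\Psi_{0,\mu}(z)$. $\partial$ is the limiting subdifferential; $\partial\Psi_{0,\mu}(z)=\{u:u_i\in\mathbb R\text{ if }z_i=0,\ u_i=0\text{ otherwise}\}$. $w^*$ is a stationary point of (D) if there exist $x\in\partial f^*(-A^\top y^*-B^\top z^* )$, $v\in\partial g^*(y^*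 )$, $u\in\partial\Psi_{0,\mu}(z^* )$ with $Ax=v$ and $Bx=b+u$. $\operatorname{ri}$ denotes relative interior. *)

(* Defs.v *)
From HB Require Import structures.
From mathcomp Require Import all_boot all_order all_algebra.
From mathcomp Require Import all_classical all_reals ereal.
Set Implicit Arguments. Unset Strict Implicit. Unset Printing Implicit Defensive.
Import Order.TTheory GRing.Theory Num.Theory.
Local Open Scope ring_scope.
Local Open Scope classical_set_scope.

Section Defs.
Variable R : realType.

Definition inner (k : nat) (u x : 'cV[R]_k) : R := \sum_(i < k) u i 0 * x i 0.

(* max norm on R^k (any norm gives the same topology) *)
Definition vnorm (k : nat) (x : 'cV[R]_k) : R := \big[Num.max/0]_(i < k) `|x i 0|.

Definition proper_fun (k : nat) (h : 'cV[R]_k -> \bar R) : Prop :=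
  (forall x, h x != -oo%E) /\ (exists x, h x \is a fin_num).

Definition lsc_fun (k : nat) (h : 'cV[R]_k -> \bar R) : Prop :=
  forall x (a : R), (a%:E < h x)%E ->
    exists2 d : R, 0 < d & forall y, vnorm (y - x) < d -> (a%:E < h y)%E.

(* convex (for functions with values in (-oo, +oo]) *)
Definition convex_fun (k : nat) (h : 'cV[R]_k -> \bar R) : Prop :=
  forall x y : 'cV[R]_k, forall t : R, 0 < t < 1 ->
    (h (t *: x + (1 - t) *: y)%R <= t%:E * h x + (1 - t)%:E * h y)%E.

Definition conj_fun (k : nat) (h : 'cV[R]_k -> \bar R) : 'cV[R]_k -> \bar R :=
  fun u => ereal_sup (range (fun x => ((inner u x)%:E - h x)%E)).

Definition dom (k : nat) (h : 'cV[R]_k -> \bar R) : set 'cV[R]_k :=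
  [set x | (h x < +oo)%E].

Definition aff_hull (k : nat) (C : set 'cV[R]_k) : set 'cV[R]_k :=
  [set x | exists (p : nat) (pts : 'I_p -> 'cV[R]_k) (lam : 'I_p -> R),
     [/\ forall i, C (pts i), \sum_(i < p) lam i = 1 &
         x = \sum_(i < p) lam i *: pts i]].

Definition ri (k : nat) (C : set 'cV[R]_k) : set 'cV[R]_k :=
  [set x | C x /\ exists2 e : R, 0 < e &
     forall y, aff_hull C y -> vnorm (y - x) < e -> C y].

Definition polyhedral_fun (k : nat) (h : 'cV[R]_k -> \bar R) : Prop :=
  exists (p : nat) (a : 'I_p -> 'cV[R]_k) (be al : 'I_p -> R),
    forall (x : 'cV[R]_k) (t : R),
      (h x <= t%:E)%E <-> (forall j, inner (a j) x + be j * t <= al j).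

Definition frechet_subdiff (k : nat) (h : 'cV[R]_k -> \bar R) (x : 'cV[R]_k)
  : set 'cV[R]_k :=
  [set v | h x \is a fin_num /\
     forall e : R, 0 < e -> exists2 d : R, 0 < d &
       forall y, 0 < vnorm (y - x) < d ->
         (h x + (inner v (y - x) - e * vnorm (y - x))%:E <= h y)%E].

Definition lim_subdiff (k : nat) (h : 'cV[R]_k -> \bar R) (x : 'cV[R]_k)
  : set 'cV[R]_k :=
  [set v | h x \is a fin_num /\
     exists (xs vs : nat -> 'cV[R]_k),
       (forall j, frechet_subdiff h (xs j) (vs j)) /\
       forall e : R, 0 < e -> exists N : nat, forall j : nat, (N <= j)%N ->
         [/\ vnorm (xs j - x) < e, vnorm (vs j - v) < e &
             `|fine (h (xs j)) - fine (h x)| < e]].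

Definition Psi0 (r : nat) (mu : 'cV[R]_r) (z : 'cV[R]_r) : R :=
  \sum_(i < r) (if z i 0 != 0 then mu i 0 else 0).

Definition Xi (n m r : nat) (f : 'cV[R]_n -> \bar R) (g : 'cV[R]_m -> \bar R)
  (A : 'M[R]_(m, n)) (B : 'M[R]_(r, n)) (b : 'cV[R]_r)
  (y : 'cV[R]_m) (z : 'cV[R]_r) : \bar R :=
  (conj_fun f (- (A^T *m y) - B^T *m z) + conj_fun g y + (inner b z)%:E)%E.

Definition Gobj (n m r : nat) (f : 'cV[R]_n -> \bar R) (g : 'cV[R]_m -> \bar R)
  (A : 'M[R]_(m, n)) (B : 'M[R]_(r, n)) (b mu : 'cV[R]_r)
  (y : 'cV[R]_m) (z : 'cV[R]_r) : \bar R :=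
  (Xi f g A B b y z + (Psi0 mu z)%:E)%E.

Definition local_min2 (m r : nat) (F : 'cV[R]_m -> 'cV[R]_r -> \bar R)
  (ys : 'cV[R]_m) (zs : 'cV[R]_r) : Prop :=
  exists2 e : R, 0 < e & forall y z,
    vnorm (y - ys) < e -> vnorm (z - zs) < e -> (F ys zs <= F y z)%E.

Definition stationary (n m r : nat) (f : 'cV[R]_n -> \bar R) (g : 'cV[R]_m -> \bar R)
  (A : 'M[R]_(m, n)) (B : 'M[R]_(r, n)) (b mu : 'cV[R]_r)
  (ys : 'cV[R]_m) (zs : 'cV[R]_r) : Prop :=
  exists (x : 'cV[R]_n) (v : 'cV[R]_m) (u : 'cV[R]_r),
    [/\ lim_subdiff (conj_fun f) (- (A^T *m ys) - B^T *m zs) x,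
        lim_subdiff (conj_fun g) ys v,
        lim_subdiff (fun z => (Psi0 mu z)%:E) zs u,
        A *m x = v & B *m x = b + u].

Definition slater (n m r : nat) (f : 'cV[R]_n -> \bar R) (g : 'cV[R]_m -> \bar R)
  (A : 'M[R]_(m, n)) (B : 'M[R]_(r, n)) (zs : 'cV[R]_r) : Prop :=
  exists (y : 'cV[R]_m) (z : 'cV[R]_r),
    [/\ ri (dom (conj_fun f)) (- (A^T *m y) - B^T *m z) \/
          (polyhedral_fun (conj_fun f) /\ dom (conj_fun f) (- (A^T *m y) - B^T *m z)),
        ri (dom (conj_fun g)) y \/
          (polyhedral_fun (conj_fun g) /\ dom (conj_fun g) y) &
        forall i, zs i 0 = 0 -> z i 0 = 0].

End Defs.

(* Main.v *)
Require Import Defs.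
From HB Require Import structures.
From mathcomp Require Import all_boot all_order all_algebra.
From mathcomp Require Import all_classical all_reals ereal.
From mathcomp Require Import ring lra.
Set Implicit Arguments. Unset Strict Implicit. Unset Printing Implicit Defensive.
Import Order.TTheory GRing.Theory Num.Theory.
Local Open Scope ring_scope.
Local Open Scope classical_set_scope.

(* For (i), limiting subgradients of the conjugates are global subgradients, and
   near [zs] the jump of the penalty dominates the linear term [inner u (z - zs)]
   because [u] vanishes on the support of [zs].

   For (ii), the local minimum is a global minimum of the convex function [Xi] on
   the subspace of the [z] supported in the support of [zs]. Writing this problem
   over the two epigraphs, with the linear constraint [s = - A^T y - B^T z], makes
   the objective linear; the stationarity point [x] is the multiplier of that
   constraint. Multipliers come from a Farkas lemma for affine inequalities over a
   convex set [C] that has a feasible point in its relative interior: [C] contains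
   the epigraph of each non-polyhedral conjugate as a factor, while a polyhedral
   epigraph enters through its inequalities. Only the algebraic relative interior
   matters, so the lemma is proved in any real vector space, by induction on the
   number of constraints. *)

(** * Multipliers for affine constraints over a convex set *)

Section AffineFarkas.
Context {R : realType} {V : lmodType R}.
Implicit Types (C : set V) (x y : V) (l c : V -> R).

(** The parameter ranges over all of [R]: for [t > 1] the point lies beyond [x], as seen from
    [y]. *)
Definition comb (t : R) x y : V := t *: x + (1 - t) *: y.

Lemma comb_combl t s x y : comb s (comb t x y) x = comb (s * t + (1 - s)) x y.
Proof.
rewrite /comb scalerDr !scalerA addrAC -scalerDl; congr (_ + _ *: _); ring.
Qed.

Definition affine l := forall t x y, l (comb t x y) = t * l x + (1 - t) * l y.

Definition cvx_set C := forall t x y, 0 <= t <= 1 -> C x -> C y -> C (comb t x y).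

(** These are the affine subspaces, the empty one included. *)
Definition flat_set C := forall t x y, C x -> C y -> C (comb t x y).

(* The algebraic relative interior: every segment from a point of [C] to [x0]
   can be prolonged beyond [x0] inside [C]. *)
Definition icr C : set V :=
  [set x0 | C x0 /\ forall x, C x -> exists2 t, 1 < t & C (comb t x0 x)].

Lemma affine_cst (k : R) : affine (fun=> k).
Proof. by move=> t x y; ring. Qed.

Lemma affineD l l' : affine l -> affine l' -> affine (fun x => l x + l' x).
Proof. by move=> al al' t x y; rewrite al al'; ring. Qed.

Lemma affineM k l : affine l -> affine (fun x => k * l x).
Proof. by move=> al t x y; rewrite al; ring. Qed.

Lemma cvx_setI C D : cvx_set C -> cvx_set D -> cvx_set (C `&` D).
Proof. by move=> cC cD t x y ht [Cx Dx] [Cy Dy]; split; [exact: cC|exact: cD]. Qed.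

Lemma cvx_halfspace l : affine l -> cvx_set [set x | l x <= 0].
Proof. by move=> al t x y ht /= lx ly; rewrite al; nra. Qed.

Lemma flat_cvx C : flat_set C -> cvx_set C.
Proof. by move=> fC t x y _; exact: fC. Qed.

Lemma flat_hyperplane l : affine l -> flat_set [set x | l x = 0].
Proof. by move=> al t x y /= lx ly; rewrite al lx ly; ring. Qed.

(** By convexity the whole segment from [x0] to a prolonged point lies in [C], so prolongations can
    be cut to a common length. *)
Lemma icr_shrink C x0 x : cvx_set C -> icr C x0 -> C x ->
  exists2 e : R, 0 < e & forall d, 0 <= d <= e -> C (comb (1 + d) x0 x).
Proof.
move=> cC [Cx0 ix0] Cx; have [t t1 Ct] := ix0 x Cx.
exists (t - 1) => [|d /andP[d0 dt]]; first by lra.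
have t10 : t - 1 != 0 by lra.
have -> : comb (1 + d) x0 x = comb (d / (t - 1)) (comb t x0 x) x0.
  by rewrite comb_combl; congr comb; field.
apply: cC => //; rewrite divr_ge0 //=; last by lra.
by rewrite ler_pdivrMr ?mul1r //; lra.
Qed.

(** A suitable average of [x1] and a point beyond [x0] lies beyond the midpoint. *)
Lemma icr_midpoint C x0 x1 : cvx_set C -> icr C x0 -> C x1 ->
  icr C (comb 2^-1 x0 x1).
Proof.
move=> cC [Cx0 ix0] Cx1; split=> [|x Cx]; first by apply: cC => //; lra.
have [t t1 Ct] := ix0 x Cx; have t0 : t + 1 != 0 by lra.
have t0' : 0 < (t + 1)^-1 by rewrite invr_gt0; lra.
exists (2 * t / (t + 1)); first by rewrite ltr_pdivlMr; lra.
have -> : comb (2 * t / (t + 1)) (comb 2^-1 x0 x1) x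
        = comb (t + 1)^-1 (comb t x0 x) x1.
  rewrite /comb !scalerDr !scalerA addrAC.
  by congr (_ *: _ + _ *: _ + _ *: _); field.
apply: cC => //; rewrite ltW //= invf_le1; lra.
Qed.

Lemma icr_halfspace C l x0 : cvx_set C -> affine l -> icr C x0 -> l x0 < 0 ->
  icr (C `&` [set x | l x <= 0]) x0.
Proof.
move=> cC al ix0 lx0; split; first by split; [case: ix0|exact: ltW].
move=> x [Cx /= lx]; have [e e0 he] := icr_shrink cC ix0 Cx.
have dx : 0 < 1 - l x by lra.
(* The second bound uses up at most the slack [- l x0]; the [1 -] keeps the denominator positive
   when [l x = 0]. *)
pose d := Num.min e (- l x0 / (1 - l x)).
have d0 : 0 < d by rewrite lt_min e0 divr_gt0 //; lra.
have de : d <= e by rewrite ge_min lexx.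
have : d <= - l x0 / (1 - l x) by rewrite ge_min lexx orbT.
rewrite ler_pdivlMr // => dl.
exists (1 + d); first by lra.
split; first by apply: he; lra.
by rewrite /= al; nra.
Qed.

Lemma icr_flat C D x0 : flat_set D -> icr C x0 -> D x0 -> icr (C `&` D) x0.
Proof.
move=> fD [Cx0 ix0] Dx0; split=> // x [Cx Dx].
by have [t t1 Ct] := ix0 x Cx; exists t => //; split => //; exact: fD.
Qed.

(* Two points on opposite sides of [l = 0] are joined by a segment crossing it. *)
Lemma ratio_le C c l x y : cvx_set C -> affine c -> affine l ->
  (forall z, C z -> l z = 0 -> 0 <= c z) ->
  C x -> C y -> 0 < l x -> l y < 0 -> - c x / l x <= c y / - l y.
Proof.
move=> cC ac al hc Cx Cy lx ly.
have d0 : 0 < l x - l y by lra.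
have dn0 : l x - l y != 0 by lra.
pose t := - l y / (l x - l y).
have Cz : C (comb t x y).
  apply: cC => //; rewrite divr_ge0 /=; [|lra|lra].
  by rewrite ler_pdivrMr // mul1r; lra.
have := hc _ Cz; rewrite al ac => /(_ _).
have e : t * l x + (1 - t) * l y = 0 by rewrite /t; field.
move=> /(_ e).
have -> : t * c x + (1 - t) * c y = (- l y * c x + l x * c y) / (l x - l y).
  by rewrite /t; field.
rewrite pmulr_lge0 ?invr_gt0 // => h.
rewrite ler_pdivrMr // mulrAC ler_pdivlMr; nra.
Qed.

(** The multiplier is the infimum of the ratios over the side [l < 0]; by [ratio_le] it dominates
    those of the side [l > 0]. A lower bound [k] of the ratios passes to [q], and [k = 0] yields a
    nonnegative multiplier. *)
Lemma single_multiplier C c l : cvx_set C -> affine c -> affine l ->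
  (forall z, C z -> l z = 0 -> 0 <= c z) ->
  (exists2 y, C y & l y < 0) ->
  forall k, (forall y, C y -> l y < 0 -> k <= c y / - l y) ->
  exists2 q : R, k <= q & forall x, C x -> 0 <= c x + q * l x.
Proof.
move=> cC ac al hc [y0 Cy0 ly0] k hk.
pose S := [set q : R | exists2 y, C y /\ l y < 0 & q = c y / - l y].
have S0 : S !=set0 by exists (c y0 / - l y0), y0.
have lbS a : (forall y, C y -> l y < 0 -> a <= c y / - l y) -> lbound S a.
  by move=> ha _ [y [Cy ly] ->]; exact: ha.
exists (inf S); first by apply: lb_le_inf => //; exact: lbS.
move=> x Cx; have [lx|lx|lx] := ltgtP (l x) 0.
- have : inf S <= c x / - l x.
    by apply: ge_inf; [exists k; exact: lbS|exists x].
  by rewrite ler_pdivlMr; nra.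
- have : - c x / l x <= inf S.
    by apply: lb_le_inf => //; apply: lbS => y Cy ly; exact: (@ratio_le C).
  by rewrite ler_pdivrMr; nra.
- by rewrite lx mulr0 addr0 hc.
Qed.

(** If [l] does not vanish on [C], prolonging a segment through [x0] gives points on both sides of
    the hyperplane, and a ratio from the side [l > 0] serves as [k]. *)
Lemma equality_multiplier C c l x0 : cvx_set C -> affine c -> affine l ->
  icr C x0 -> l x0 = 0 ->
  (forall z, C z -> l z = 0 -> 0 <= c z) ->
  exists q : R, forall x, C x -> 0 <= c x + q * l x.
Proof.
move=> cC ac al ix0 lx0 hc.
have [all0|/existsNP[x1 /not_implyP[Cx1 lx1]]] :=
  pselect (forall x, C x -> l x = 0).
  by exists 0 => x Cx; rewrite mul0r addr0 hc // all0.
have [t t1 Ct] := ix0.2 _ Cx1.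
pose x2 := comb t x0 x1.
have lx2 : l x2 = (1 - t) * l x1 by rewrite /x2 al lx0; ring.
have [[x Cx lx] [y Cy ly]] : (exists2 x, C x & 0 < l x) /\ (exists2 y, C y & l y < 0).
  have [h|h|//] := ltgtP (l x1) 0; split.
  - by exists x2 => //; rewrite lx2; nra.
  - by exists x1.
  - by exists x1.
  - by exists x2 => //; rewrite lx2; nra.
have [] := @single_multiplier C c l cC ac al hc _ (- c x / l x).
- by exists y.
- by move=> w Cw lw; exact: (@ratio_le C).
- by move=> q _ hq; exists q.
Qed.

(** Induction on the constraints: the first one is kept as a hyperplane cutting [C] and released at
    the end by [equality_multiplier]. *)
Lemma equality_multipliers (I : eqType) (s : seq I) (e : I -> V -> R) C c x0 :
  uniq s -> cvx_set C -> affine c -> (forall i, affine (e i)) ->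
  icr C x0 -> (forall i, e i x0 = 0) ->
  (forall x, C x -> (forall i, i \in s -> e i x = 0) -> 0 <= c x) ->
  exists q : I -> R, forall x, C x -> 0 <= c x + \sum_(i <- s) q i * e i x.
Proof.
move=> us cC ac ae ix0 ex0; elim: s us C c cC ac ix0 => [|a s IH] us C c cC ac ix0 hc.
  by exists (fun=> 0) => x Cx; rewrite big_nil addr0 hc.
case/andP: us => nas us.
have [||q hq] := IH us _ c (cvx_setI cC (flat_cvx (flat_hyperplane (ae a)))) ac.
- exact: icr_flat (flat_hyperplane (ae a)) ix0 (ex0 a).
- move=> x [Cx ax] hx; apply: hc => // i; rewrite inE => /orP[/eqP->//|]; exact: hx.
have aS : affine (fun x => c x + \sum_(i <- s) q i * e i x).
  apply: affineD => //; elim: (s) => [|j s' IHs] t x y.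
    by rewrite !big_nil; ring.
  by rewrite !big_cons IHs ae; ring.
have [|k hk] := @equality_multiplier C _ (e a) x0 cC aS (ae a) ix0 (ex0 a).
  by move=> z Cz ez; exact: hq.
(* As [a] is not in [s], redefining [q] at [a] leaves the sum over [s] unchanged. *)
exists (fun i => if i == a then k else q i) => x Cx.
rewrite big_cons eqxx (eq_big_seq (fun i => q i * e i x)); last first.
  by move=> i si; case: eqP si nas => // -> ->.
by have := hk x Cx; lra.
Qed.

(* The inequality [l a <= 0] is either strict at some feasible point, and then
   single_multiplier applies, or it is an implicit equality. In the latter case
   the multiplier of the equality may be negative; it is then cancelled by a
   combination of the constraints, with coefficient 1 on [l a], that is
   nonnegative on [C]. *)
Lemma affine_farkas_seq (I : Type) (l : I -> V -> R) (s : seq I) C c x0 :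
  (forall i, affine (l i)) -> cvx_set C -> affine c ->
  icr C x0 -> all (fun i => l i x0 <= 0) s ->
  (forall x, C x -> all (fun i => l i x <= 0) s -> 0 <= c x) ->
  exists h, [/\ affine h, forall x, all (fun i => l i x <= 0) s -> h x <= 0 &
                forall x, C x -> 0 <= c x + h x].
Proof.
move=> al; elim: s C c x0 => [|a s IH] C c x0 cC ac ix0.
  move=> _ hc; exists (fun=> 0); split=> //; first exact: affine_cst.
  by move=> x Cx; rewrite addr0 hc.
move=> /= /andP[lx0 lsx0] hc.
have [[x1 [Cx1 lsx1] lx1]|noslack] := pselect
    (exists2 x, C x /\ all (fun i => l i x <= 0) s & l a x < 0).
  (* The midpoint inherits relative interiority from [x0] and strictness from [x1]. *)
  have ix2 := icr_midpoint cC ix0 Cx1; set x2 := comb _ _ _ in ix2.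
  have lx2 : l a x2 < 0 by rewrite al; lra.
  have lsx2 : all (fun i => l i x2 <= 0) s.
    elim: (s) lsx0 lsx1 => //= i s' IHs /andP[h0 hs0] /andP[h1 hs1].
    by rewrite IHs // andbT al; lra.
  have [|h [ah hls hC]] := IH _ c x2 (cvx_setI cC (cvx_halfspace (al a))) ac
    (icr_halfspace cC (al a) ix2 lx2) lsx2.
    by move=> x [Cx lx] lsx; apply: hc => //=; rewrite lx.
  have [|||q q0 hq] := @single_multiplier C _ (l a) cC (affineD ac ah) (al a) _ _ 0.
  - by move=> z Cz lz; apply: hC; split=> //=; rewrite lz.
  - by exists x1.
  - by move=> y Cy ly; rewrite divr_ge0 ?hC //; [split=> //; exact: ltW|lra].
  exists (fun x => h x + q * l a x); split.
  - by apply: affineD => //; exact: affineM.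
  - by move=> x /andP[lx lsx]; have := hls x lsx; nra.
  - by move=> x Cx; rewrite addrA hq.
have l0 x : C x -> all (fun i => l i x <= 0) s -> 0 <= l a x.
  by move=> Cx lsx; rewrite leNgt; apply/negP => lx; apply: noslack; exists x.
have lx00 : l a x0 = 0 by apply/eqP; rewrite eq_le lx0 l0 //; case: ix0.
(* With [l a] itself as objective, the other constraints give [h'] with [l a + h' >= 0] on [C]. *)
have [h' [ah' hls' hC']] := IH C (l a) x0 cC (al a) ix0 lsx0 l0.
have flat := flat_hyperplane (al a).
have [|h [ah hls hC]] := IH _ c x0 (cvx_setI cC (flat_cvx flat)) ac
    (icr_flat flat ix0 lx00) lsx0.
  by move=> x [Cx /= lx] lsx; apply: hc => //; rewrite lx lexx.
have [|q hq] := @equality_multiplier C _ (l a) x0 cC (affineD ac ah) (al a) ix0 lx00.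
  by move=> z Cz lz; exact: hC.
have [q0|q0] := leP 0 q.
  exists (fun x => h x + q * l a x); split.
  - by apply: affineD => //; exact: affineM.
  - by move=> x /andP[lx lsx]; have := hls x lsx; nra.
  - by move=> x Cx; rewrite addrA hq.
exists (fun x => h x + (- q) * h' x); split.
- by apply: affineD => //; exact: affineM.
- by move=> x /andP[lx lsx]; have := hls x lsx; have := hls' x lsx; nra.
- by move=> x Cx; have := hq x Cx; have := hC' x Cx; nra.
Qed.

(** Of the nonnegative combination of the [l i], [h] retains only that it is affine and is
    nonpositive wherever all [l i] are. *)
Lemma affine_farkas (I : finType) (l : I -> V -> R) C c x0 :
  (forall i, affine (l i)) -> cvx_set C -> affine c ->
  icr C x0 -> (forall i, l i x0 <= 0) ->
  (forall x, C x -> (forall i, l i x <= 0) -> 0 <= c x) ->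
  exists h, [/\ affine h, forall x, (forall i, l i x <= 0) -> h x <= 0 &
                forall x, C x -> 0 <= c x + h x].
Proof.
have allE x : all (fun i => l i x <= 0) (enum I) <-> forall i, l i x <= 0.
  split=> [/allP hx i|hx]; first by apply: hx; rewrite mem_enum.
  by apply/allP => i _; exact: hx.
move=> al cC ac ix0 /allE lx0 hc.
have [|h [ah hl hC]] := affine_farkas_seq al cC ac ix0 lx0.
  by move=> x Cx /allE; exact: hc.
by exists h; split=> // x /allE; exact: hl.
Qed.

End AffineFarkas.

(** * Relative interiors of products *)

Section ProductSets.
Context {R : realType} {V W : lmodType R}.
Implicit Types (C : set V) (D : set W).

Lemma cvx_setX C D : cvx_set C -> cvx_set D -> cvx_set (C `*` D).
Proof. by move=> cC cD t x y t01 [? ?] [? ?]; split; [exact: cC|exact: cD]. Qed.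

(** Both factors must be prolonged by the same amount, hence the minimum of the two lengths. *)
Lemma icr_setX C D x0 y0 : cvx_set C -> cvx_set D ->
  icr C x0 -> icr D y0 -> icr (C `*` D) (x0, y0).
Proof.
move=> cC cD ix0 iy0; split; first by split; [case: ix0|case: iy0].
move=> [x y] [Cx Dy].
have [d d0 hd] := icr_shrink cC ix0 Cx; have [e e0 he] := icr_shrink cD iy0 Dy.
have de0 : 0 < Num.min d e by rewrite lt_min d0.
exists (1 + Num.min d e); first by lra.
by split; [apply: hd|apply: he]; rewrite ltW //= ge_min lexx ?orbT.
Qed.

Lemma icr_flat_self D y0 : flat_set D -> D y0 -> icr D y0.
Proof. by move=> fD Dy0; split=> // y Dy; exists 2; [lra|exact: fD]. Qed.

End ProductSets.

(** Testing against real upper bounds removes the infinite cases: [+oo] has none, and those of [-oo]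
    are arbitrarily small. *)
Lemma lee_upper (R : realType) (a : R) (e : \bar R) :
  (forall c : R, (e <= c%:E)%E -> a <= c) -> (a%:E <= e)%E.
Proof.
move=> h; case: e h => [c| |] h; first by rewrite lee_fin h.
  by rewrite leey.
by exfalso; have {h} := h (a - 1) (leNye _); lra.
Qed.

(** * Inner product and max norm *)

Section InnerNorm.
Context {R : realType} {k : nat}.
Implicit Types (u v x y : 'cV[R]_k) (t : R).

Lemma innerDl u v x : inner (u + v) x = inner u x + inner v x.
Proof. by rewrite -big_split; apply: eq_bigr => i _; rewrite mxE mulrDl. Qed.

Lemma innerZl t u x : inner (t *: u) x = t * inner u x.
Proof. by rewrite /inner mulr_sumr; apply: eq_bigr => i _; rewrite mxE mulrA. Qed.

Lemma innerC u x : inner u x = inner x u.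
Proof. by apply: eq_bigr => i _; rewrite mulrC. Qed.

Lemma innerDr u x y : inner u (x + y) = inner u x + inner u y.
Proof. by rewrite innerC innerDl !(innerC u). Qed.

Lemma innerZr t u x : inner u (t *: x) = t * inner u x.
Proof. by rewrite innerC innerZl innerC. Qed.

Lemma innerNr u x : inner u (- x) = - inner u x.
Proof. by rewrite -scaleN1r innerZr mulN1r. Qed.

Lemma innerNl u x : inner (- u) x = - inner u x.
Proof. by rewrite innerC innerNr innerC. Qed.

Lemma innerBr u x y : inner u (x - y) = inner u x - inner u y.
Proof. by rewrite innerDr innerNr. Qed.

Lemma innerBl u v x : inner (u - v) x = inner u x - inner v x.
Proof. by rewrite innerDl innerNl. Qed.

Lemma inner_delta u i : inner u (delta_mx i 0) = u i 0.
Proof.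
rewrite /inner (bigD1 i) //= mxE !eqxx mulr1 big1 ?addr0 // => j ji.
by rewrite mxE (negbTE ji) mulr0.
Qed.

Lemma vnorm_ge0 x : 0 <= vnorm x.
Proof. by rewrite /vnorm; elim/big_ind: _ => // a b a0 b0; rewrite le_max a0. Qed.

Lemma ler_vnorm x i : `|x i 0| <= vnorm x.
Proof. by rewrite /vnorm; exact: (le_bigmax _ (fun j => `|x j 0|)). Qed.

Lemma vnorm_le x (a : R) : 0 <= a -> (forall i, `|x i 0| <= a) -> vnorm x <= a.
Proof. by move=> a0 h; rewrite /vnorm; apply: bigmax_le => // i _. Qed.

Lemma vnorm0 : vnorm (0 : 'cV[R]_k) = 0.
Proof.
by apply/eqP; rewrite eq_le vnorm_ge0 andbT vnorm_le // => i; rewrite mxE normr0.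
Qed.

Lemma vnorm_eq0 x : vnorm x = 0 -> x = 0.
Proof.
move=> x0; apply/colP => i; rewrite mxE; apply/eqP.
by rewrite -normr_eq0 eq_le normr_ge0 andbT -x0 ler_vnorm.
Qed.

Lemma vnormZ t x : vnorm (t *: x) = `|t| * vnorm x.
Proof.
apply/eqP; rewrite eq_le; apply/andP; split.
  apply: vnorm_le => [|i]; first by rewrite mulr_ge0 ?vnorm_ge0.
  by rewrite mxE normrM ler_wpM2l ?ler_vnorm.
have [->|t0] := eqVneq t 0; first by rewrite normr0 mul0r vnorm_ge0.
rewrite mulrC -ler_pdivlMr ?normr_gt0 //; apply: vnorm_le => [|i].
  by rewrite divr_ge0 ?vnorm_ge0.
rewrite ler_pdivlMr ?normr_gt0 // mulrC -normrM.
by have := ler_vnorm (t *: x) i; rewrite mxE.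
Qed.

Lemma vnorm_delta i : vnorm (delta_mx i 0 : 'cV[R]_k) = 1.
Proof.
apply/eqP; rewrite eq_le; apply/andP; split.
  by apply: vnorm_le => // j; rewrite mxE; case: (_ && _); rewrite ?normr1 ?normr0.
by have := ler_vnorm (delta_mx i 0) i; rewrite mxE !eqxx normr1.
Qed.

Lemma inner_vnorm u x : `|inner u x| <= k%:R * (vnorm u * vnorm x).
Proof.
rewrite (le_trans (ler_norm_sum _ _ _)) //.
rewrite (le_trans (y := \sum_(i < k) vnorm u * vnorm x)) //.
  by apply: ler_sum => i _; rewrite normrM ler_pM ?ler_vnorm.
by rewrite sumr_const card_ord mulr_natl.
Qed.

End InnerNorm.

Lemma inner_mulmx (R : realType) (m n : nat) (A : 'M[R]_(m, n)) u x :
  inner u (A^T *m x) = inner (A *m u) x.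
Proof.
rewrite /inner.
under eq_bigr => i _ do rewrite mxE big_distrr /=.
rewrite exchange_big /=; apply: eq_bigr => j _.
by rewrite mxE big_distrl /=; apply: eq_bigr => i _; rewrite mxE; ring.
Qed.

(** * Subgradients of functions with convex epigraph *)

Section ConvexSubgradient.
Context {R : realType} {k : nat}.
Implicit Types (h : 'cV[R]_k -> \bar R) (x v : 'cV[R]_k).

(** [R^o] is [R] as a module over itself, so that the epigraph lives in an [lmodType]. *)
Definition epi h : set ('cV[R]_k * R^o) := [set p | (h p.1 <= (p.2 : R)%:E)%E].

Definition subgradient h x v :=
  h x \is a fin_num /\ forall y, (h x + (inner v (y - x))%:E <= h y)%E.

Lemma conj_fun_le h u (a : R) :
  (conj_fun h u <= a%:E)%E <-> forall x, ((inner u x)%:E - h x <= a%:E)%E.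
Proof.
split=> [ha x|ha]; last by apply: ge_ereal_sup => _ [x _ <-].
by apply: le_trans ha; apply: ereal_sup_ubound; exists x.
Qed.

(** The epigraph is an intersection of convex sets, one for each [x]: a half-space, everything or
    nothing, as [h x] is finite, [+oo] or [-oo]. *)
Lemma cvx_epi_conj h : cvx_set (epi (conj_fun h)).
Proof.
move=> t p q /andP[t0 t1] /conj_fun_le hp /conj_fun_le hq.
apply/conj_fun_le => x /=; move: (hp x) (hq x).
case: (h x) => [c| |] /=; last 2 first.
- by move=> _ _; rewrite addeNy leNye.
- by [].
- rewrite !lee_fin innerDl !innerZl /GRing.scale /= => h1 h2; nra.
Qed.

Lemma conj_fun_neqNy h u : proper_fun h -> conj_fun h u != -oo%E.
Proof.
move=> [_ [x hx]]; rewrite -ltNye.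
apply: (@lt_le_trans _ _ ((inner u x)%:E - h x)%E).
  by rewrite -(fineK hx) ltNyr.
by apply: ereal_sup_ubound; exists x.
Qed.

Lemma subgradient_lim h x v : subgradient h x v -> lim_subdiff h x v.
Proof.
move=> [hx sub]; split=> //; exists (fun=> x), (fun=> v); split=> [_|e e0].
  split=> // e e0; exists 1 => // y _; apply: le_trans (sub y).
  by rewrite leeD2l // lee_fin gerBl mulr_ge0 ?vnorm_ge0 ?ltW.
by exists 0%N => j _; rewrite !subrr vnorm0 normr0.
Qed.

(** On the segment to [y], the local inequality and convexity give, after division by [t], the
    global inequality up to [e]. *)
Lemma frechet_subgradient h x v : cvx_set (epi h) ->
  frechet_subdiff h x v -> subgradient h x v.
Proof.
move=> ch [hx fr]; split=> // y.
have [->|yx] := eqVneq y x.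
  by rewrite subrr -(scale0r x) innerZr mul0r adde0.
have n0 : 0 < vnorm (y - x).
  rewrite lt_def vnorm_ge0 andbT; apply: contraNN yx => /eqP /vnorm_eq0 /eqP.
  by rewrite subr_eq0.
rewrite -(fineK hx) -EFinD; apply: lee_upper => c hyc.
apply/ler_addgt0Pr => e e0.
(* With this scaling the error at distance [t * vnorm (y - x)] is [t * e]. *)
have [d d0 hd] := fr _ (divr_gt0 e0 n0).
pose t : R := Num.min 2^-1 (d / (2 * vnorm (y - x))).
have t0 : 0 < t by rewrite lt_min invr_gt0 ltr0n divr_gt0 // mulr_gt0.
have t1 : t <= 2^-1 by rewrite ge_min lexx.
have tn : t * vnorm (y - x) < d.
  have : t <= d / (2 * vnorm (y - x)) by rewrite ge_min lexx orbT.
  by rewrite ler_pdivlMr ?mulr_gt0 //; lra.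
have zE : comb t y x - x = t *: (y - x).
  by rewrite /comb scalerBl scale1r scalerBr addrA addrAC addrK.
have hz : (h (comb t y x) <= (t * c + (1 - t) * fine (h x))%:E)%E.
  have := ch t (y, c) (x, fine (h x)); apply => //=; first by lra.
  by rewrite /epi /= fineK.
have := hd (comb t y x); rewrite zE vnormZ gtr0_norm // mulr_gt0 // tn.
move=> /(_ isT) /le_trans /(_ hz).
rewrite -[h x in X in X -> _]fineK // -EFinD lee_fin innerZr.
have -> : e / vnorm (y - x) * (t * vnorm (y - x)) = t * e.
  by field; rewrite gt_eqF.
move=> le_t; have : t * (fine (h x) + inner v (y - x)) <= t * (c + e) by lra.
by rewrite ler_pM2l.
Qed.

(** Convexity makes the approximating Frechet subgradients global, and global inequalities pass to
    the limit. *)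
Lemma lim_subgradient h x v : cvx_set (epi h) ->
  lim_subdiff h x v -> subgradient h x v.
Proof.
move=> ch [hx [xs [vs [fr cv]]]]; split=> // y.
have sub j : subgradient h (xs j) (vs j) by exact: frechet_subgradient.
rewrite -(fineK hx) -EFinD; apply: lee_upper => c hyc.
apply/ler_addgt0Pr => e e0.
(* [d * M] bounds the total error: the [1] accounts for the function value, the rest for the three
   cross terms of [splitE]. *)
pose M := 1 + k%:R * (vnorm (y - x) + vnorm v + 1).
have kM : 0 <= k%:R :> R by [].
have M0 : 0 < M.
  by rewrite ltr_wpDr // mulr_ge0 // !addr_ge0 ?vnorm_ge0.
pose d := Num.min 1 (e / M).
have d0 : 0 < d by rewrite lt_min ltr01 divr_gt0.
have d1 : d <= 1 by rewrite ge_min lexx.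
have dM : d * M <= e by rewrite -ler_pdivlMr // ge_min lexx orbT.
have [N hN] := cv d d0; have [hx' hv' hh] := hN N (leqnn N).
have [fj /(_ y) /le_trans /(_ hyc)] := sub N.
rewrite -(fineK fj) -EFinD lee_fin => le_c.
have splitE : inner (vs N) (y - xs N) = inner v (y - x)
    + inner (vs N - v) (y - x) - inner v (xs N - x)
    - inner (vs N - v) (xs N - x).
  by rewrite !(innerBr, innerBl); ring.
have b1 := inner_vnorm (vs N - v) (y - x).
have b2 := inner_vnorm v (xs N - x).
have b3 := inner_vnorm (vs N - v) (xs N - x).
have c1 : vnorm (vs N - v) * vnorm (y - x) <= d * vnorm (y - x).
  by rewrite ler_wpM2r ?vnorm_ge0 // ltW.
have c2 : vnorm v * vnorm (xs N - x) <= d * vnorm v.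
  by rewrite mulrC ler_wpM2r ?vnorm_ge0 // ltW.
have c3 : vnorm (vs N - v) * vnorm (xs N - x) <= d * 1.
  by rewrite ler_pM ?vnorm_ge0 //; [exact: ltW|lra].
have {c1}b1 := le_trans b1 (ler_wpM2l kM c1).
have {c2}b2 := le_trans b2 (ler_wpM2l kM c2).
have {c3}b3 := le_trans b3 (ler_wpM2l kM c3).
move: b1 b2 b3 hh; rewrite !ler_norml ltr_norml.
move=> /andP[b1 _] /andP[_ b2] /andP[_ b3] /andP[hh _].
move: dM; rewrite /M => dM; rewrite splitE in le_c; lra.
Qed.

End ConvexSubgradient.

(** * Epigraphs near relative interior points of the domain *)

Section EpigraphPresentation.
Context {R : realType} {k : nat}.
Implicit Types (h : 'cV[R]_k -> \bar R) (s : 'cV[R]_k).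

Lemma aff_hull_comb (C : set 'cV[R]_k) t x y : C x -> C y -> aff_hull C (comb t x y).
Proof.
move=> Cx Cy; exists 2%N, (fun i => if i == ord0 then x else y),
  (fun i => if i == ord0 then t else 1 - t); split.
- by move=> i; case: ifP.
- by rewrite !big_ord_recl big_ord0 /=; ring.
- by rewrite !big_ord_recl big_ord0 /= addr0.
Qed.

(** Relative interiority prolongs only the base point, where [h] may be large; the unit margin above
    the graph absorbs this once the prolongation is shortened by [th]. *)
Lemma icr_epi_ri h s0 : cvx_set (epi h) -> (forall s, h s != -oo%E) ->
  ri (dom h) s0 -> icr (epi h) (s0, fine (h s0) + 1).
Proof.
move=> ch hN [ds0 [e e0 he]].
have fin s : dom h s -> h s \is a fin_num.
  by move=> ds; rewrite fin_numE hN -ltey.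
have hs0 := fin _ ds0; set a0 := fine (h s0).
split=> [|[s a] hsa]; first by rewrite /epi /= -(fineK hs0) lee_fin lerDl.
have ds : dom h s by exact: le_lt_trans hsa (ltry _).
have n1 : 0 < 1 + vnorm (s0 - s) by rewrite ltr_wpDr ?vnorm_ge0.
pose d := e / (1 + vnorm (s0 - s)); have d0 : 0 < d by rewrite divr_gt0.
have : dom h (comb (1 + d) s0 s).
  apply: he; first exact: aff_hull_comb.
  have -> : comb (1 + d) s0 s - s0 = d *: (s0 - s).
    rewrite /comb opprD addrA subrr add0r scaleNr scalerDl scale1r scalerBr.
    by rewrite addrC -addrA addKr.
  by rewrite vnormZ gtr0_norm // mulrAC ltr_pdivrMr // ltr_pM2l // ltrDr.
move=> /fin; set s1 := comb _ _ _ => hs1.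
pose K := fine (h s1) - a0 - d * (a0 + 1 - a).
have K1 : 0 < 1 + `|K| by rewrite ltr_wpDr.
pose th := (1 + `|K|)^-1.
have th0 : 0 < th by rewrite invr_gt0.
have th1 : th <= 1 by rewrite invf_le1 // lerDl.
have thK : th * K <= 1.
  by rewrite mulrC ler_pdivrMr // mul1r (le_trans (ler_norm _)) // lerDr.
exists (th * (1 + d) + (1 - th)).
  by rewrite mulrDr mulr1 addrAC addrCA subrr addr0 ltrDl mulr_gt0.
have : epi h (comb th (s1, fine (h s1) : R^o) (s0, a0 : R^o)).
  by apply: ch; [rewrite ltW|rewrite /epi /= fineK|rewrite /epi /= fineK].
rewrite /epi /= -!/(comb _ _ _) comb_combl => /le_trans; apply.
rewrite lee_fin /comb /GRing.scale /=; move: thK; rewrite /K; lra.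
Qed.

(* [E] is the epigraph itself at a relative interior point, and the whole space
   in the polyhedral case. *)
Lemma epi_presentation h s0 : cvx_set (epi h) -> (forall s, h s != -oo%E) ->
  ri (dom h) s0 \/ (polyhedral_fun h /\ dom h s0) ->
  exists (E : set ('cV[R]_k * R^o)) (p : nat) (l : 'I_p -> 'cV[R]_k * R^o -> R)
         (a0 : R),
    [/\ cvx_set E, forall j, affine (l j), icr E (s0, a0),
        forall j, l j (s0, a0) <= 0 &
        forall q, epi h q <-> E q /\ forall j, l j q <= 0].
Proof.
move=> ch hN [rs0|[[p [a [be [al hp]]]] ds0]].
  exists (epi h), 0%N, (fun _ _ => 0), (fine (h s0) + 1).
  split=> //; first by case.
    exact: icr_epi_ri.
  by move=> q; split=> [hq|[]]; first by split=> //; case.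
pose l j (q : 'cV[R]_k * R^o) : R := inner (a j) q.1 + be j * q.2 - al j.
have epiE q : epi h q <-> forall j, l j q <= 0.
  split=> [/hp hq j|hq]; first by rewrite subr_le0; exact: hq.
  by apply/hp => j; rewrite -subr_le0; exact: hq.
exists setT, p, l, (fine (h s0)); split=> //.
- move=> j t x y; rewrite /l /comb /= innerDr !innerZr /GRing.scale /=; ring.
- exact: icr_flat_self.
- by apply/epiE; rewrite /epi /= fineK // fin_numE hN -ltey.
- by move=> q; rewrite epiE; split=> [|[]].
Qed.

End EpigraphPresentation.

(** * The cardinality penalty and its limiting subgradients *)

Section CardinalityPenalty.
Context {R : realType} {r : nat} {mu : 'cV[R]_r}.
Hypothesis mu0 : forall i, 0 < mu i 0.
Implicit Types z u : 'cV[R]_r.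

Lemma support_stable z : exists2 d : R, 0 < d &
  forall z', vnorm (z' - z) < d -> forall i, z i 0 != 0 -> z' i 0 != 0.
Proof.
(* The smallest nonzero absolute value, capped at [1], which also covers [z = 0]. *)
pose d := \big[Num.min/1]_(i | z i 0 != 0) `|z i 0|.
exists d => [|z' hz' i zi].
  by apply: lt_bigmin => // i zi; rewrite normr_gt0.
have : `|(z' - z) i 0| < `|z i 0|.
  apply: (le_lt_trans (ler_vnorm _ i)); apply: (lt_le_trans hz').
  exact: bigmin_le_cond.
by rewrite !mxE; apply: contraTneq => ->; rewrite sub0r normrN ltxx.
Qed.

Lemma Psi0_local z u : (forall i, z i 0 != 0 -> u i 0 = 0) ->
  exists2 d : R, 0 < d & forall z', vnorm (z' - z) < d ->
    Psi0 mu z + inner u (z' - z) <= Psi0 mu z'.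
Proof.
move=> hu; have [d d0 hd] := support_stable z.
(* Within this radius [u i * z' i] stays below the jump [mu i], and the default [d] preserves the
   support of [z]; the [1 +] avoids a zero denominator. *)
pose e := \big[Num.min/d]_i (mu i 0 / (1 + `|u i 0|)).
have u1 i : 0 < 1 + `|u i 0| by rewrite ltr_wpDr.
exists e; first by apply: lt_bigmin => // i _; rewrite divr_gt0.
move=> z' hz'; rewrite /Psi0 /inner -big_split /=; apply: ler_sum => i _.
have [zi|zi] := eqVneq (z i 0) 0; last first.
  rewrite hu // mul0r addr0 hd //.
  by apply: (lt_le_trans hz'); exact: bigmin_le_id.
rewrite add0r !mxE zi subr0; have [->|z'i] := eqVneq (z' i 0) 0.
  by rewrite mulr0.
have zn : `|z' i 0| <= mu i 0 / (1 + `|u i 0|).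
  have := ler_vnorm (z' - z) i; rewrite !mxE zi subr0 => /le_trans; apply.
  by apply: (le_trans (ltW hz')); exact: bigmin_le.
rewrite (le_trans (ler_norm _)) // normrM.
move: zn; rewrite ler_pdivlMr //.
have := normr_ge0 (z' i 0); have := normr_ge0 (u i 0); nra.
Qed.

Lemma Psi0_lim_subdiff z u : (forall i, z i 0 != 0 -> u i 0 = 0) ->
  lim_subdiff (fun z => (Psi0 mu z)%:E) z u.
Proof.
move=> hu; split=> //; exists (fun=> z), (fun=> u); split=> [_|e e0]; last first.
  by exists 0%N => j _; rewrite !subrr vnorm0 normr0.
split=> // e e0; have [d d0 hd] := Psi0_local hu.
exists d => // z' /andP[_ /hd]; rewrite -EFinD lee_fin; apply: le_trans.
by rewrite lerD2l gerBl mulr_ge0 ?vnorm_ge0 ?ltW.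
Qed.

(** Moving coordinate [i] by plus or minus [t < |z i|] leaves the penalty unchanged, so [|u i|] is
    at most every [e > 0]. *)
Lemma Psi0_frechet_eq0 z u i :
  frechet_subdiff (fun z => (Psi0 mu z)%:E) z u -> z i 0 != 0 -> u i 0 = 0.
Proof.
move=> [_ fr] zi; apply/eqP; rewrite -normr_eq0 eq_le normr_ge0 andbT.
apply/ler_addgt0Pr => e e0; rewrite add0r; have [d d0 hd] := fr e e0.
have zi0 : 0 < `|z i 0| by rewrite normr_gt0.
pose t := Num.min d `|z i 0| / 2.
have m0 : 0 < Num.min d `|z i 0| by rewrite lt_min d0.
have t0 : 0 < t by rewrite divr_gt0.
have td : t < d.
  by rewrite ltr_pdivrMr // (@le_lt_trans _ _ d) ?ge_min ?lexx // ltr_pMr // ltr1n.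
have tz : t < `|z i 0|.
  rewrite ltr_pdivrMr // (@le_lt_trans _ _ `|z i 0|) ?ge_min ?lexx ?orbT //.
  by rewrite ltr_pMr // ltr1n.
have key (w : R) : `|w| = t -> w * u i 0 <= t * e.
  move=> wt; have := hd (z + w *: delta_mx i 0).
  rewrite addrAC subrr add0r vnormZ vnorm_delta mulr1 wt t0 td => /(_ isT).
  rewrite -EFinD lee_fin innerZr inner_delta.
  suff -> : Psi0 mu (z + w *: delta_mx i 0) = Psi0 mu z by lra.
  apply: eq_bigr => j _; congr (if _ then _ else _); rewrite !mxE andbT.
  have [->|ji] := eqVneq j i; last by rewrite mulr0 addr0.
  rewrite zi mulr1; apply/eqP => zw; move: tz.
  by rewrite -wt -normrN (_ : - w = z i 0) ?ltxx //; lra.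
rewrite ler_norml; apply/andP; split.
  have := key (- t); rewrite normrN gtr0_norm // => /(_ erefl) h.
  rewrite -(ler_pM2l t0); lra.
by have := key t; rewrite gtr0_norm // => /(_ erefl); rewrite ler_pM2l.
Qed.

(** Points near [z] keep its support, so the Frechet case applies to them. *)
Lemma Psi0_lim_eq0 z u i :
  lim_subdiff (fun z => (Psi0 mu z)%:E) z u -> z i 0 != 0 -> u i 0 = 0.
Proof.
move=> [_ [zs [us [fr cv]]]] zi; apply/eqP; rewrite -normr_eq0 eq_le normr_ge0 andbT.
apply/ler_addgt0Pr => e e0; rewrite add0r.
have [d d0 hd] := support_stable z.
have de0 : 0 < Num.min d e by rewrite lt_min d0.
have [N /(_ N (leqnn N))[hz hu _]] := cv _ de0.
have ui : us N i 0 = 0.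
  apply: (Psi0_frechet_eq0 (fr N)); apply: hd zi.
  by apply: (lt_le_trans hz); rewrite ge_min lexx.
have := ler_vnorm (us N - u) i; rewrite !mxE ui sub0r normrN => /le_trans; apply.
by rewrite (le_trans (ltW hu)) // ge_min lexx orbT.
Qed.

End CardinalityPenalty.

(** * Stationary points and local minimizers *)

Section DualProblem.
Context {R : realType} {n m r : nat}.
Variables (f : 'cV[R]_n -> \bar R) (g : 'cV[R]_m -> \bar R).
Variables (A : 'M[R]_(m, n)) (B : 'M[R]_(r, n)) (b mu : 'cV[R]_r).
Hypotheses (pf : proper_fun f) (pg : proper_fun g) (mu0 : forall i, 0 < mu i 0).

Let F := conj_fun f.
Let G := conj_fun g.
Let slope (y : 'cV[R]_m) (z : 'cV[R]_r) : 'cV[R]_n := - (A^T *m y) - B^T *m z.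

Lemma inner_slope x y z : inner x (slope y z) = - inner (A *m x) y - inner (B *m x) z.
Proof. by rewrite innerBr innerNr !inner_mulmx. Qed.

Lemma slope_comb t y z y' z' :
  slope (comb t y y') (comb t z z') = comb t (slope y z) (slope y' z').
Proof.
rewrite /slope /comb !mulmxDr -!scalemxAr !scalerBr !scalerN !opprD.
by rewrite [RHS]addrACA.
Qed.

Lemma Gobj_fin y z : F (slope y z) \is a fin_num -> G y \is a fin_num ->
  Gobj f g A B b mu y z =
    (fine (F (slope y z)) + fine (G y) + inner b z + Psi0 mu z)%:E.
Proof. by move=> Fs Gy; rewrite /Gobj /Xi -/F -/G -(fineK Fs) -(fineK Gy). Qed.

Lemma Gobj_le y z (a c : R) : epi F (slope y z, a : R^o) -> epi G (y, c : R^o) ->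
  (Gobj f g A B b mu y z <= (a + c + inner b z + Psi0 mu z)%:E)%E.
Proof. by move=> Fa Gc; rewrite /Gobj /Xi -/F -/G !EFinD !leeD2r // leeD. Qed.

Lemma Gobj_lty y z : (Gobj f g A B b mu y z < +oo)%E ->
  F (slope y z) \is a fin_num /\ G y \is a fin_num.
Proof.
have := conj_fun_neqNy (slope y z) pf; have := conj_fun_neqNy y pg.
rewrite /Gobj /Xi -/F -/G -/(slope y z).
by case: (F _) => [?| |] //; case: (G _) => [?| |].
Qed.

(** The three subgradient inequalities add up; the linear terms in [y] cancel by [A *m x = v], those
    in [z] by [B *m x = b + u]. *)
Lemma stationary_local_min ys zs :
  stationary f g A B b mu ys zs -> local_min2 (Gobj f g A B b mu) ys zs.
Proof.
move=> [x [v [u [hx hv hu AxE BxE]]]].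
have [Fs subF] := lim_subgradient (@cvx_epi_conj _ _ f) hx.
have [Gs subG] := lim_subgradient (@cvx_epi_conj _ _ g) hv.
rewrite -/(slope ys zs) -/F in Fs subF; rewrite -/G in Gs subG.
have [|d d0 hd] := @Psi0_local _ _ _ mu0 zs u.
  by move=> i; exact: Psi0_lim_eq0 hu.
exists d => // y z _ hz; rewrite (Gobj_fin Fs Gs).
apply: lee_upper => c hc.
have [Fyz Gy] := Gobj_lty (le_lt_trans hc (ltry _)).
move: hc; rewrite Gobj_fin // lee_fin; apply: le_trans.
have := subF (slope y z); have := subG y.
rewrite -(fineK Fs) -(fineK Gs) -(fineK Fyz) -(fineK Gy) -!EFinD !lee_fin.
have := hd z hz; rewrite !(inner_slope, innerBr) AxE BxE !innerDl; lra.
Qed.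

(** * Multipliers at a local minimizer *)

Section Necessity.
Variables (ys : 'cV[R]_m) (zs : 'cV[R]_r).
Hypothesis lmin : local_min2 (Gobj f g A B b mu) ys zs.
Hypotheses (Fs : F (slope ys zs) \is a fin_num) (Gs : G ys \is a fin_num).

Definition subsupport : set 'cV[R]_r := [set z | forall i, zs i 0 = 0 -> z i 0 = 0].

Lemma flat_subsupport : flat_set subsupport.
Proof. by move=> t x y hx hy i zi; rewrite !mxE hx // hy // !mulr0 addr0. Qed.

(* The penalty is constant near [zs] on [subsupport], so there the local minimum
   is one of the convex function [Xi]. *)
Lemma Xi_min_subsupport y z (a c : R) : subsupport z ->
  epi F (slope y z, a : R^o) -> epi G (y, c : R^o) ->
  fine (F (slope ys zs)) + fine (G ys) + inner b zs <= a + c + inner b z.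
Proof.
move=> sz Fa Gc; have [e e0 he] := lmin; have [d d0 hd] := support_stable zs.
pose de := Num.min 1 (Num.min e d).
have de0 : 0 < de by rewrite !lt_min ltr01 e0.
(* Both displacements are below [N], so the step [t] keeps both blocks within [de]; the [1 +] makes
   this strict and, with [de <= 1], gives [t <= 1]. *)
pose N := 1 + vnorm (y - ys) + vnorm (z - zs).
have ny := vnorm_ge0 (y - ys); have nz := vnorm_ge0 (z - zs).
have N0 : 0 < N by rewrite /N; lra.
pose t := de / N; have t0 : 0 < t by rewrite divr_gt0.
have tN : t * N = de by rewrite divfK // gt_eqF.
have t1 : t <= 1.
  have : de <= 1 by rewrite ge_min lexx.
  by rewrite -tN /N; nra.
have near k (x xs : 'cV[R]_k) (q : R) : vnorm (x - xs) < N -> de <= q ->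
    vnorm (comb t x xs - xs) < q.
  move=> xN deq; have -> : comb t x xs - xs = t *: (x - xs).
    by rewrite /comb scalerBl scale1r scalerBr addrA addrAC addrK.
  rewrite vnormZ gtr0_norm //; apply: lt_le_trans deq.
  by rewrite -tN ltr_pM2l.
have [yN zN] : vnorm (y - ys) < N /\ vnorm (z - zs) < N by rewrite /N; lra.
have dee : de <= e by rewrite !ge_min lexx orbT.
have ded : de <= d by rewrite !ge_min lexx !orbT.
have := he (comb t y ys) (comb t z zs) (near _ _ _ _ yN dee) (near _ _ _ _ zN dee).
have t01 : 0 <= t <= 1 by rewrite ltW.
have Fc : epi F (comb t (slope y z, a : R^o) (slope ys zs, fine (F (slope ys zs)) : R^o)).
  by apply: cvx_epi_conj => //; rewrite /epi /= fineK.
have Gcc : epi G (comb t (y, c : R^o) (ys, fine (G ys) : R^o)).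
  by apply: cvx_epi_conj => //; rewrite /epi /= fineK.
move: Fc; rewrite [comb _ _ _]surjective_pairing /= -/(comb _ _ _) -slope_comb => Fc.
move: Gcc; rewrite [comb _ _ _]surjective_pairing /= -/(comb _ _ _) => Gcc.
rewrite (Gobj_fin Fs Gs) => /le_trans /(_ (Gobj_le Fc Gcc)).
(* Zeros stay zero by [subsupport]; nonzero entries stay nonzero by the choice of [d]. *)
have -> : Psi0 mu (comb t z zs) = Psi0 mu zs.
  apply: eq_bigr => i _; congr (if _ then _ else _).
  have [zi|zi] := eqVneq (zs i 0) 0; last exact: hd (near _ _ _ _ zN ded) _ zi.
  have szs : subsupport zs by [].
  by rewrite (flat_subsupport t sz szs) ?eqxx.
rewrite lee_fin innerDr !innerZr /GRing.scale /= => le_t.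
rewrite -(ler_pM2l t0); lra.
Qed.

Let V : lmodType R := ('cV[R]_n * R^o * ('cV[R]_m * R^o) * 'cV[R]_r)%type.

(** The blocks [(s, a)], [(y, c)] and [z] become independent once [x] prices the coupling
    [s = slope y z]. *)
Lemma local_min_multiplier : slater f g A B zs ->
  exists x : 'cV[R]_n, forall s (a : R) y (c : R) z,
    epi F (s, a : R^o) -> epi G (y, c : R^o) -> subsupport z ->
    fine (F (slope ys zs)) + fine (G ys) + inner b zs <=
    a + c + inner b z - inner x (s - slope y z).
Proof.
move=> [y0 [z0 [Sf Sg Sz]]].
have [EF [p [lF [a0 [cEF aF iF lF0 epiF]]]]] :=
  epi_presentation (@cvx_epi_conj _ _ f) (fun s => conj_fun_neqNy s pf) Sf.
have [EG [p' [lG [c0 [cEG aG iG lG0 epiG]]]]] :=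
  epi_presentation (@cvx_epi_conj _ _ g) (fun s => conj_fun_neqNy s pg) Sg.
rewrite -/(slope y0 z0) -/F -/G in iF iG lF0 lG0 epiF epiG.
pose C : set V := (EF `*` EG) `*` subsupport.
have csub := flat_cvx flat_subsupport.
have cC : cvx_set C by apply: cvx_setX => //; exact: cvx_setX.
pose q0 : V := ((slope y0 z0, a0 : R^o), (y0, c0 : R^o), z0).
have iC : icr C q0.
  apply: icr_setX => //; [exact: cvx_setX|exact: icr_setX|].
  by apply: icr_flat_self => //; exact: flat_subsupport.
pose e (i : 'I_n) (q : V) : R := (q.1.1.1 - slope q.1.2.1 q.2) i 0.
have ae i : affine (e i).
  move=> t x y; rewrite /e /= -!/(comb _ _ _) slope_comb !mxE; ring.
have e0 i : e i q0 = 0 by rewrite /e subrr mxE.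
pose X0 := fine (F (slope ys zs)) + fine (G ys) + inner b zs.
pose obj (q : V) : R := (q.1.1.2 : R) + q.1.2.2 + inner b q.2 - X0.
have aobj : affine obj.
  move=> t x y; rewrite /obj /= innerDr !innerZr /GRing.scale /=; ring.
pose l (j : 'I_p + 'I_p') (q : V) : R :=
  match j with inl j => lF j q.1.1 | inr j => lG j q.1.2 end.
have al j : affine (l j) by case: j => j t x y; [exact: aF|exact: aG].
(* The coupling first stays in the convex set, as a flat, while [affine_farkas] treats the
   polyhedral inequalities; its multipliers are extracted afterwards over [C]. *)
pose D : set V := [set q | forall i, e i q = 0].
have fD : flat_set D by move=> t x y hx hy i; rewrite ae hx hy !mulr0 addr0.
have [||h [ah hl hC]] := affine_farkas al (cvx_setI cC (flat_cvx fD)) aobj (icr_flat fD iC e0).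
- by case.
- move=> [[[s a] [y c]] z] [[[/= Es Ey] sz] Dq] hq.
  rewrite subr_ge0; apply: (@Xi_min_subsupport y z a c sz).
    have <- : s = slope y z.
      by apply/eqP; rewrite -subr_eq0; apply/eqP/colP => i; rewrite [RHS]mxE; exact: (Dq i).
    by apply/epiF; split=> // j; exact: (hq (inl j)).
  by apply/epiG; split=> // j; exact: (hq (inr j)).
have [|q hq] := equality_multipliers (index_enum_uniq 'I_n) cC (affineD aobj ah) ae iC e0.
  by move=> x Cx hx; apply: hC; split=> // i; apply: hx; exact: mem_index_enum.
(* The sign matches [- inner x] in the claim, and [h], nonpositive at feasible points, drops out. *)
exists (- \col_i q i) => s a y c z /epiF[Es lFs] /epiG[Ey lGy] sz.
have := hq ((s, a : R^o), (y, c : R^o), z) (conj (conj Es Ey) sz).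
have : h ((s, a : R^o), (y, c : R^o), z) <= 0 by apply: hl; case.
have -> : \sum_i q i * e i ((s, a : R^o), (y, c : R^o), z) =
          inner (\col_i q i) (s - slope y z).
  by apply: eq_bigr => i _; rewrite [in RHS]mxE.
rewrite innerNl /obj /X0 /=; lra.
Qed.

(** Varying one block at a time in the multiplier inequality, with the others at the minimizer,
    gives each stationarity condition. *)
Lemma local_min_stationary : slater f g A B zs -> stationary f g A B b mu ys zs.
Proof.
move=> /local_min_multiplier[x hx].
have FsE : epi F (slope ys zs, fine (F (slope ys zs)) : R^o) by rewrite /epi /= fineK.
have GsE : epi G (ys, fine (G ys) : R^o) by rewrite /epi /= fineK.
have szs : subsupport zs by [].
(* A coordinate in the support of [zs] may move in both directions, so its linear coefficient
   vanishes. *)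
have uT i : zs i 0 != 0 -> (B *m x - b) i 0 = 0.
  move=> zi; have key (t : R) : 0 <= t * (b - B *m x) i 0.
    have := hx _ _ _ _ (zs + t *: delta_mx i 0) FsE GsE.
    have sd : subsupport (zs + t *: delta_mx i 0).
      move=> j zj; rewrite !mxE zj add0r andbT.
      by have [ji|_] := eqVneq j i; rewrite ?mulr0 //; rewrite -ji zj eqxx in zi.
    move=> /(_ sd); rewrite !(inner_slope, innerBr) !innerDr !innerZr !inner_delta.
    by rewrite !mxE; lra.
  by have := key 1; have := key (-1); rewrite !mxE; lra.
have uz : inner (B *m x - b) zs = 0.
  rewrite /inner big1 // => i _.
  by have [->|/uT ->] := eqVneq (zs i 0) 0; rewrite ?mulr0 ?mul0r.
rewrite innerBl in uz.
exists x, (A *m x), (B *m x - b); split=> //.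
- apply: subgradient_lim; split=> // s; rewrite -/F -/(slope _ _).
  rewrite -(fineK Fs) -EFinD; apply: lee_upper => a Fa.
  have := hx s a _ _ _ Fa GsE szs; rewrite !(inner_slope, innerBr); lra.
- apply: subgradient_lim; split=> // y; rewrite -/G.
  rewrite -(fineK Gs) -EFinD; apply: lee_upper => c Gc.
  have := hx _ _ y c _ FsE Gc szs; rewrite !(inner_slope, innerBr); lra.
- exact: Psi0_lim_subdiff.
- by rewrite addrC subrK.
Qed.

End Necessity.
End DualProblem.

Theorem mainTheorem16 (R : realType) (n m r : nat)
  (f : 'cV[R]_n -> \bar R) (g : 'cV[R]_m -> \bar R)
  (A : 'M[R]_(m, n)) (B : 'M[R]_(r, n)) (b mu : 'cV[R]_r) :
  proper_fun f -> lsc_fun f -> convex_fun f ->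
  proper_fun g -> lsc_fun g -> convex_fun g ->
  (forall i, 0 < mu i 0) ->
  (forall (ys : 'cV[R]_m) (zs : 'cV[R]_r),
      stationary f g A B b mu ys zs -> local_min2 (Gobj f g A B b mu) ys zs) /\
  (forall (ys : 'cV[R]_m) (zs : 'cV[R]_r),
      local_min2 (Gobj f g A B b mu) ys zs ->
      (Gobj f g A B b mu ys zs < +oo)%E ->
      slater f g A B zs ->
      stationary f g A B b mu ys zs).
Proof.
move=> pf _ _ pg _ _ mu0; split=> [ys zs|ys zs lmin fin sl].
  exact: stationary_local_min.
have [Fs Gs] := Gobj_lty pf pg fin.
exact: local_min_stationary.
Qed.
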